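(* Let $K$ be a field of characteristic two with fixed algebraic closure $K^{\mathrm{alg}}$, let $M\subset K^{\mathrm{alg}}$ be a separable extension of $K$ of degree two, and let $N\subset K^{\mathrm{alg}}$ be a separable extension of $M$ of degree not exceeding two. Let $F,G,H\in K$ and $q,r,s\in K^{\mathrm{alg}}$ be such that $q^2+q=F$, $r^2+r=Gq+H$, $s^2+s=G$, $M=K[q]$ and $N=M[r]$. Then the following statements, exactly one of which applies (i.e. exactly one of whose hypotheses is satisfied), all hold: (1) If $[G]=0$ over $K$ and $[H]=[Fs^2]$ over $M$, then $N=M$. (2) If $[G]=0$ over $K$ and $[H]\neq[Fs^2]$ over $M$, then $N$ is a Galois extension of $K$, and $\mathrm{Gal}(N|K)\cong\mathbb{Z}/2\mathbb{Z}\times\mathbb{Z}/2\mathbb{Z}$. (3) If $[G]=[F]$ over $K$, then $N$ is a Galois extension of $K$, and $\mathrm{Gal}(N|K)\cong\mathbb{Z}/4\mathbb{Z}$. (4) If $[G]\neq 0$ over $M$, then $N$ is not a Galois extension of $K$, and $\mathrm{Gal}(\widetilde{N}|K)\cong D_4$, where $\widetilde{N}$ denotes the Galois closure of $N$ over $K$.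
   Context: For a field $E$ of characteristic two, let $\wp(x)=x^2+x$. For $x\in E$, ''$[x]$ over $E$'' denotes the class of $x$ in the additive group $E/\wp(E)$; thus $[x]=[y]$ over $E$ means $x+y=\alpha^2+\alpha$ for some $\alpha\in E$. $D_4$ is the dihedral group of order 8. Note that if $[G]=0$ over $K$ then $s\in K$, so that $Fs^2\in K\subseteq M$. *)

(* Defs.v *)
From HB Require Import structures.
From mathcomp Require Export all_boot all_order all_algebra.
From mathcomp Require Export all_fingroup all_solvable all_field.

Set Implicit Arguments.
Unset Strict Implicit.
Unset Printing Implicit Defensive.

Import GRing.Theory.
Local Open Scope ring_scope.

Definition wp (E : fieldType) (x : E) : E := x ^+ 2 + x.

(* [x] = [y] in S / wp(S), for x and y in the subfield S of a field E of
   characteristic two. *)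
Definition class_eq (E : fieldType) (S : E -> Prop) (x y : E) : Prop :=
  exists2 a, S a & x + y = wp a.

(* The subring S[x] of E, for a subring S of E. *)
Definition ring_adjoin (E : fieldType) (S : E -> Prop) (x : E) : E -> Prop :=
  fun y => exists2 p : {poly E}, (forall i, S p`_i) & y = p.[x].

Definition field_image (E E' : fieldType) (f : E -> E') : E' -> Prop :=
  fun y => exists x, y = f x.

Definition subfield_image (K : fieldType) (L : fieldExtType K) (E : fieldType)
    (f : L -> E) (V : {subfield L}) : E -> Prop :=
  fun y => exists2 x, x \in V & y = f x.

(* L is normal over its base field, so the Galois closure of N over U (in any
   extension of L) is contained in L. *)
Definition galois_closure (K : fieldType) (L : splittingFieldType K)
    (U N E : {subfield L}) : Prop :=
  [/\ (N <= E)%VS, galois U E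
    & forall E' : {subfield L}, (N <= E')%VS -> galois U E' -> (E <= E')%VS].

Definition exactly_one4 (P1 P2 P3 P4 : Prop) : Prop :=
  [\/ [/\ P1, ~ P2, ~ P3 & ~ P4], [/\ ~ P1, P2, ~ P3 & ~ P4],
      [/\ ~ P1, ~ P2, P3 & ~ P4] | [/\ ~ P1, ~ P2, ~ P3 & P4]].

(* Main.v *)
(** An automorphism over K acts by q -> q + e, s -> s + d, r -> r + e s + c with
   bits e, d, c, and its square fixes q and s and sends r to r + e d.  If s lies
   in K then d = 0 and the group has exponent two, while t = r + s q satisfies
   t^2 + t = H + F s^2 and N = M[t].  If s + q lies in K then d = e and there is
   an element of order four.  If s is not in M then e and d are independent, and
   automorphisms with (e, d) = (1, 0) and (0, 1) are involutions whose product
   has order four, so they generate D_4.  The Galois closure of K[q, r] is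
   K[q, r, s], because a(r) + r is s or s + 1 for an automorphism a moving q. *)
Require Import Defs.
From mathcomp Require Import ring.

Set Implicit Arguments.
Unset Strict Implicit.
Unset Printing Implicit Defensive.

Import GRing.Theory.
Local Open Scope ring_scope.

(** * The additive map [wp] in characteristic two *)

Section ArtinSchreier.

Variables (E : fieldType).
Hypothesis char2 : 2%N \in [pchar E].

(* Rewriting rules with which [ring] reduces the coefficients 2 and 3. *)
Lemma pchar2_numerals : (2%:R = 0 :> E) * (3%:R = 1 :> E).
Proof.
have E2: 2%:R = 0 :> E by exact: pcharf0 char2.
by split; rewrite // (natrD _ 2 1) E2 add0r.
Qed.

Lemma wpD (x y : E) : wp (x + y) = wp x + wp y.
Proof. by have [c2 c3] := pchar2_numerals; rewrite /wp; ring: c2 c3. Qed.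

Lemma wp_eq0 (x : E) : wp x = 0 -> x = 0 \/ x = 1.
Proof.
rewrite /wp -[x in _ + x]mulr1 expr2 -mulrDr => /eqP.
by rewrite mulf_eq0 addr_eq0 (oppr_pchar2 char2) => /orP[]/eqP->; [left|right].
Qed.

Lemma wp1 : wp (1 : E) = 0.
Proof. by rewrite /wp expr1n (addrr_pchar2 char2). Qed.

(** [wp] is additive with kernel {0, 1}, so its nonempty fibres are pairs [x], [x + 1]. *)
Lemma wp_inj2 (x y : E) : wp x = wp y -> x = y \/ x = y + 1.
Proof.
move=> wpxy; have /wp_eq0[] : wp (x + y) = 0.
- by rewrite wpD wpxy (addrr_pchar2 char2).
- by move/eqP; rewrite addr_eq0 (oppr_pchar2 char2) => /eqP; left.
by move=> xy1; right; rewrite -xy1 addrC (addrK_pchar2 char2).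
Qed.

End ArtinSchreier.

Lemma fmorph_wp (E E' : fieldType) (f : {rmorphism E -> E'}) (x : E) :
  f (wp x) = wp (f x).
Proof. by rewrite /wp rmorphD rmorphXn. Qed.

(** * Extensions generated by one root of [wp y = c] *)

Section QuadraticExtension.

Variables (F0 : fieldType) (L : splittingFieldType F0).
Hypothesis char2 : 2%N \in [pchar L].
Implicit Types (U E : {subfield L}) (x y : L).

Lemma rpred_wp U x : x \in U -> wp x \in U.
Proof. by move=> Ux; rewrite rpredD ?rpredX. Qed.

Let wpX x : {poly L} := 'X^2 + 'X - (wp x)%:P.

Let wpX_over U x : wp x \in U -> wpX x \is a polyOver U.
Proof.
by move=> Ux; rewrite rpredB ?polyOverC // rpredD ?rpredX ?polyOverX.
Qed.

Let root_wpX x y : root (wpX x) y = (wp y == wp x).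
Proof. by rewrite /root !hornerE -/(wp y) subr_eq0. Qed.

Let size_wpX x : size (wpX x) = 3%N.
Proof.
by rewrite /wpX -addrA size_polyDl size_polyXn // size_XsubC.
Qed.

Let wpX_monic x : wpX x \is monic.
Proof.
by rewrite monicE lead_coefE size_wpX !coefE /= subr0 addr0.
Qed.

Lemma wp_separable U x : wp x \in U -> separable_element U x.
Proof.
move=> Uwx; apply/separable_elementP; exists (wpX x).
rewrite wpX_over // root_wpX eqxx; split=> //; rewrite unlock.
(* In characteristic two the derivative is the constant 1, to which [wpX x] is coprime. *)
rewrite /wpX derivB derivD derivXn derivX derivC subr0 -scaler_nat.
by rewrite (pcharf0 char2) scale0r add0r coprimep1.
Qed.

(** The quadratic on the right vanishes at [x], and the minimal polynomial of an element outside [U]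
    has degree at least two. *)
Lemma wp_minPoly U x :
  wp x \in U -> x \notin U -> minPoly U x = 'X^2 + 'X - (wp x)%:P.
Proof.
move=> Uwx U'x; apply/eqP; rewrite -eqp_monic ?monic_minPoly ?wpX_monic //.
have dvd_minX: (minPoly U x %| wpX x)%R.
  by rewrite minPoly_dvdp ?wpX_over ?root_wpX.
rewrite -(dvdp_size_eqp dvd_minX) size_wpX size_minPoly eqn_leq.
have:= dvdp_leq (monic_neq0 (wpX_monic x)) dvd_minX.
rewrite size_wpX size_minPoly => -> /=; rewrite !ltnS.
by move: U'x; rewrite -adjoin_deg_eq1 /adjoin_degree eqSS -lt0n.
Qed.

Lemma wp_adjoin_degree U x :
  wp x \in U -> x \notin U -> adjoin_degree U x = 2%N.
Proof.
by move=> Uwx U'x; apply: succn_inj; rewrite -size_minPoly wp_minPoly ?size_wpX.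
Qed.

Lemma wp_dim U x : wp x \in U -> x \notin U -> \dim <<U; x>> = (2 * \dim U)%N.
Proof. by move=> Uwx U'x; rewrite dim_Fadjoin wp_adjoin_degree. Qed.

Lemma wp_FadjoinP U x y : wp x \in U -> y \in <<U; x>>%VS ->
  exists u v, [/\ u \in U, v \in U & y = u + v * x].
Proof.
move=> Uwx; have [Ux | U'x] := boolP (x \in U).
  by rewrite (Fadjoin_idP Ux) => Uy; exists y, 0; rewrite rpred0 mul0r addr0.
move=> /Fadjoin_poly_eq <-; have Up := polyOverP (Fadjoin_polyOver U x y).
have:= size_Fadjoin_poly U x y.
rewrite wp_adjoin_degree // => sz.
exists (Fadjoin_poly U x y)`_0, (Fadjoin_poly U x y)`_1; split=> //.
by rewrite (horner_coef_wide _ sz) big_ord_recl big_ord1 /= expr0 mulr1 expr1.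
Qed.

(** Linear independence of 1 and [x] over [U], in the form used to compare coefficients of [x]. *)
Lemma Fadjoin_coef_eq0 U x u v :
  x \notin U -> u \in U -> v \in U -> u + v * x \in U -> v = 0.
Proof.
move=> U'x Uu Uv; rewrite rpredDl // => Uvx; apply/eqP.
apply: contraNT U'x => nz_v.
by rewrite -(mulKf nz_v x) rpredM ?rpredV.
Qed.

(** With [y = u + v * x] one gets [wp y = wp u + v ^+ 2 * wp x + wp v * x]. Comparing coefficients
    of [x] gives [wp v = 0], so [v] is 0 or 1. *)
Lemma wp_mem_Fadjoin U x y : wp x \in U -> wp y \in U ->
  y \in <<U; x>>%VS -> y \in U \/ x + y \in U.
Proof.
move=> Uwx Uwy; have [c2 c3] := pchar2_numerals char2.
have [Ux | U'x] := boolP (x \in U); first by rewrite (Fadjoin_idP Ux); left.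
case/(wp_FadjoinP Uwx)=> u [v [Uu Uv Dy]].
have /(wp_eq0 char2): wp v = 0.
  apply: (@Fadjoin_coef_eq0 U x (wp u + v ^+ 2 * wp x)) => //.
  - by rewrite rpredD ?rpredM ?rpredX ?(Uwx, rpred_wp).
  - exact: rpred_wp.
  suffices ->: wp u + v ^+ 2 * wp x + wp v * x = wp y by [].
  by rewrite Dy /wp; ring: c2 c3.
case=> // Dv; [left | right]; rewrite Dy Dv ?mul0r ?addr0 //.
by rewrite mul1r addrC (addrK_pchar2 char2).
Qed.

(** In the same expansion of [wp (u + v * x)], the coefficient of [x] is [wp v]. *)
Lemma wp_eq_linear U x y g h : wp x \in U -> x \notin U -> g \in U -> h \in U ->
  y \in <<U; x>>%VS -> wp y = g * x + h -> exists2 v, v \in U & wp v = g.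
Proof.
move=> Uwx U'x Ug Uh; have [c2 c3] := pchar2_numerals char2.
case/(wp_FadjoinP Uwx)=> u [v [Uu Uv ->]] wpy; exists v => //.
apply/eqP; rewrite -subr_eq0 (GRing.subr_pchar2 char2); apply/eqP.
apply: (@Fadjoin_coef_eq0 U x (wp u + v ^+ 2 * wp x + h)) => //.
- by rewrite !rpredD ?rpredM ?rpredX ?(Uwx, rpred_wp).
- by rewrite rpredD ?rpred_wp.
suffices ->: wp u + v ^+ 2 * wp x + h + (wp v + g) * x = 0 by rewrite rpred0.
rewrite -(addrr_pchar2 char2 (wp (u + v * x))) {2}wpy.
by rewrite /wp; ring: c2 c3.
Qed.

(** [x + 1] is the other root of the minimal polynomial of [x]. *)
Lemma wp_gal U E x : (U <= E)%VS -> normalField U E -> x \in E ->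
    wp x \in U -> x \notin U ->
  exists2 a, a \in 'Gal(E / U)%g & a x = x + 1.
Proof.
move=> sUE nUE Ex Uwx U'x; apply: normalField_root_minPoly => //.
by rewrite wp_minPoly // root_wpX wpD // wp1 // addr0.
Qed.

End QuadraticExtension.

(** * Recognition of the three Galois groups *)

Section SmallGroups.

Local Open Scope group_scope.
Variables (gT : finGroupType) (G : {group gT}).

(** Both groups are elementary abelian 2-groups, and these are classified by their order. *)
Lemma isog_Z2Z2 :
  #|G| = 4%N -> {in G, forall a, a ^+ 2 = 1} -> G \isog [set: 'Z_2 * 'Z_2].
Proof.
move=> oG G2; have oZ: #|[set: 'Z_2 * 'Z_2]| = 4%N.
  by rewrite cardsT card_prod !card_ord.
have abelian4 (rT : finGroupType) (H : {group rT}) : #|H| = 4%N -> abelian H.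
  exact: (@card_p2group_abelian _ 2).
have abelG: 2.-abelem G by apply/abelemP; rewrite ?abelian4.
rewrite (isog_abelem_card [group of [set: 'Z_2 * 'Z_2]] abelG) oG oZ andbT.
apply/abelemP=> //; split=> [|[a b] _]; first exact: abelian4.
by case: a b => [[|[|//]] ?] [[|[|//]] ?]; apply/eqP.
Qed.

Lemma isog_Z4 a : #|G| = 4%N -> a \in G -> a ^+ 2 != 1 -> G \isog [set: 'Z_4].
Proof.
move=> oG Ga a2; have oZ: #|[set: 'Z_4]| = 4%N by rewrite cardsT card_ord.
have: (#[a] %| 2 ^ 2)%N by rewrite -[(2 ^ 2)%N]oG order_dvdG.
case/(dvdn_pfactor _ _ (isT : prime 2)) => -[|[|[|//]]] // _ oa.
- by move: a2; rewrite -order_dvdn oa.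
- by move: a2; rewrite -order_dvdn oa.
have cycG: cyclic G.
  apply/cyclicP; exists a; apply/eqP; rewrite eq_sym eqEcard cycle_subG Ga /=.
  by rewrite -[#|<[a]>|]/#[a] oa oG.
rewrite (isog_cyclic_card [group of [set: 'Z_4]] cycG) oZ oG eqxx andbT.
by apply/cyclicP; exists Zp1; apply: Zp_cycle.
Qed.

(** Distinct involutions generate a dihedral group. If it were proper in [G], its order would be at
    most four, so it would be abelian and [(a * b) ^+ 2] would be 1. *)
Lemma isog_D8 a b : #|G| = 8%N -> a \in G -> b \in G ->
  a ^+ 2 = 1 -> b ^+ 2 = 1 -> (a * b) ^+ 2 != 1 -> G \isog 'D_8.
Proof.
move=> oG Ga Gb a2 b2 ab2.
(* Were one factor trivial, the product would be the other one, whose square is 1. *)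
have nt (x y : gT) : x ^+ 2 = 1 -> y ^+ 2 = 1 -> (x * y) ^+ 2 != 1 ->
    #[x] = 2%N /\ #[y] = 2%N.
  move=> x2 y2 xy2; split; apply: nt_prime_order => //;
    apply: contraNneq xy2 => ->.
    by rewrite mul1g y2.
  by rewrite mulg1 x2.
have [oa ob] := nt a b a2 b2 ab2.
have neq_ab: a != b.
  by apply: contraNneq ab2 => ->; rewrite -[_ * _]/(b ^+ 2) b2 expg1n.
have sHG: <<[set a; b]>> \subset G by rewrite gen_subG subUset !sub1set Ga.
have: (#|<<[set a; b]>>| %| 2 ^ 3)%N by rewrite -[(2 ^ 3)%N]oG cardSg.
case/(dvdn_pfactor _ _ (isT : prime 2)) => m.
rewrite leq_eqVlt => /orP[/eqP-> oH | m2 oH].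
  have <-: <<[set a; b]>> = G by apply/eqP; rewrite eqEcard sHG oG oH.
  by have := involutions_gen_dihedral oa ob neq_ab; rewrite oH.
case/eqP: ab2; suffices /centP cab: a \in 'C(<<[set a; b]>>).
  by rewrite expgMn ?a2 ?b2 ?mulg1 //; apply: cab; rewrite mem_gen // set22.
have: abelian <<[set a; b]>>.
  apply: (@p2group_abelian _ 2); first by rewrite /pgroup oH pnatX.
  by rewrite oH pfactorK.
by move/subsetP; apply; rewrite mem_gen // set21.
Qed.

End SmallGroups.

(** * Testing automorphisms on generators *)

Section GaloisGenerators.

Variables (F0 : fieldType) (L : splittingFieldType F0).
Implicit Types (U V E : {subfield L}).

(** Endomorphisms of [L] are injective, so an inclusion of the image in [E] is an equality by
    dimension. *)
Lemma normalField_sub_img U E :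
  (forall f : 'AEnd(L), {in U, f =1 id} -> (f @: E <= E)%VS) -> normalField U E.
Proof.
move=> sfE; apply/forall_inP=> f; rewrite inE => /andP[/kAHomP/sfE sfEE _].
rewrite eqEdim sfEE /=.
by rewrite limg_dim_eq // (eqP (AEnd_lker0 f)) capv0.
Qed.

(** The fixed field of [a] is a subfield that contains [V] and [x]. *)
Lemma gal_fix_Fadjoin E V x (a : gal_of E) : (<<V; x>> <= E)%VS ->
  {in V, a =1 id} -> a x = x -> {in <<V; x>>%VS, a =1 id}.
Proof.
move=> sVxE aV ax y Vxy.
have [sVE Ex] := FadjoinP sVxE.
have: (<<V; x>> <= fixedField [set a])%VS.
  apply/FadjoinP; split.
    apply/subvP=> z Vz; apply/fixedFieldP; first exact: subvP Vz.
    by move=> b /set1P->; apply: aV.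
  by apply/fixedFieldP=> // b /set1P->.
by move/subvP/(_ y Vxy)/mem_fixedFieldP=> [_ ->//]; rewrite set11.
Qed.

Lemma gal_eq1 E (a : gal_of E) : {in E, a =1 id} -> a = 1%g.
Proof. by move=> aE; apply/eqP/gal_eqP=> y Ey; rewrite gal_id aE. Qed.

End GaloisGenerators.

(** * The tower from [U] through [U[q]] and [U[q, r]] to [U[q, r, s]] *)

Section Tower.

Variables (F0 : fieldType) (L : splittingFieldType F0).
Hypothesis char2 : 2%N \in [pchar L].
Variables (U : {subfield L}) (q r g h : L).
Hypotheses (Uwq : wp q \in U) (U'q : q \notin U) (Ug : g \in U) (Uh : h \in U).
Hypothesis (wpr : wp r = g * q + h).

Local Notation M := <<U; q>>%AS.
Local Notation N := <<M; r>>%AS.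

Let sUM : (U <= M)%VS. Proof. exact: subv_adjoin. Qed.
Let sMN : (M <= N)%VS. Proof. exact: subv_adjoin. Qed.
Let Mq : q \in M. Proof. exact: memv_adjoin. Qed.

Let sub_tower (E : {subfield L}) : (N <= E)%VS ->
  [/\ (U <= E)%VS, q \in E & r \in E].
Proof. by case/FadjoinP=> /FadjoinP[]. Qed.

Let Mwr : wp r \in M.
Proof. by rewrite wpr rpredD ?rpredM // (subvP sUM). Qed.

Let wpDE (x y : L) : wp (x + y) = wp x + wp y. Proof. exact: wpD. Qed.

Lemma wp_root_mem (E : {subfield L}) x y : x \in E -> wp y = wp x -> y \in E.
Proof. by move=> Ex /(wp_inj2 char2)[]->; rewrite ?rpredD ?rpred1. Qed.

(** An automorphism [a] with [a q = q + 1] gives [wp (a r + r) = g * (q + 1) + h + g * q + h = g].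
    This root puts [s] into every normal field above [N]. *)
Lemma normal_tower_root (E : {subfield L}) :
  (N <= E)%VS -> normalField U E -> exists2 s, s \in E & wp s = g.
Proof.
move=> /sub_tower[sUE Eq Er] nUE.
have [a Ga aq] := wp_gal char2 sUE nUE Eq Uwq U'q.
exists (a r + r); first by rewrite rpredD ?memv_gal.
have aU y : y \in U -> a y = y by apply: fixed_gal Ga.
rewrite wpDE -(fmorph_wp a) wpr rmorphD rmorphM /= aq !aU //.
by have [c2 c3] := pchar2_numerals char2; ring: c2 c3.
Qed.

Variable s : L.
Hypothesis wps : wp s = g.
Local Notation Nt := <<N; s>>%AS.

Let Uws : wp s \in U. Proof. by rewrite wps. Qed.
Let sNNt : (N <= Nt)%VS. Proof. exact: subv_adjoin. Qed.
Let Nts : s \in Nt. Proof. exact: memv_adjoin. Qed.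

(** Some [v] in [U] has [wp v = g], and [s] is [v] or [v + 1]. *)
Lemma tower_wp_eq_linear k x :
  k \in U -> x \in M -> wp x = g * q + k -> s \in U.
Proof.
move=> Uk Mx /(wp_eq_linear char2 Uwq U'q Ug Uk Mx)[v Uv wpv].
by apply: wp_root_mem Uv _; rewrite wps.
Qed.

Lemma tower_top_notin : s \notin U -> r \notin M.
Proof. by apply: contra => Mr; apply: tower_wp_eq_linear wpr. Qed.

(** If [s] lay in [N] but not in [M], then [r + s] would lie in [M]. Since
    [wp (r + s) = g * q + (h + g)], this would force [s] into [U]. *)
Lemma tower_root_notin : s \notin M -> s \notin N.
Proof.
move=> M's; apply/negP=> Ns.
case: (wp_mem_Fadjoin char2 Mwr (subvP sUM _ Uws) Ns) => [|Mrs].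
  exact/negP.
case/negP: M's; apply/(subvP sUM)/(tower_wp_eq_linear _ Mrs (k := h + g)).
  by rewrite rpredD.
by rewrite wpDE wpr wps addrA.
Qed.

(** Separates three situations: [s] in [U], [s + q] in [U], and [s] outside [M]. *)
Lemma tower_root_trichotomy :
  [/\ s \in U \/ s + q \in U -> s \in M,
      s \in M -> s \in U \/ s + q \in U & ~ (s \in U /\ s + q \in U)].
Proof.
split.
- case=> [/(subvP sUM)// | Usq].
  by rewrite -(addrK_pchar2 char2 q s) rpredD // (subvP sUM).
- by case/(wp_mem_Fadjoin char2 Uwq Uws); [left | right; rewrite addrC].
by case=> Us; rewrite rpredDl // (negPf U'q).
Qed.

(** [f] commutes with [wp], so it moves [q] and [s] by bits. As [e] is a bit,
    [wp (f r + r) = e g = wp (e s)], which fixes [f r] up to a further bit [c]. *)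
Lemma tower_action (f : 'AEnd(L)) : {in U, f =1 id} -> exists e c d : bool,
  [/\ f q = q + e%:R, f r = r + e%:R * s + c%:R & f s = s + d%:R].
Proof.
move=> fU; have [c2 c3] := pchar2_numerals char2.
have f_wp (x : L) : wp x \in U -> exists e : bool, f x = x + e%:R.
  move=> /fU; rewrite fmorph_wp => /(wp_inj2 char2)[]->; last by exists true.
  by exists false; rewrite addr0.
have [[e fq] [d fs]] := (f_wp q Uwq, f_wp s Uws).
have: wp (f r + r) = wp (e%:R * s).
  rewrite wpDE -(fmorph_wp f) wpr rmorphD rmorphM /= fq (fU g) // (fU h) //.
  case: e {fq} => /=; rewrite ?mul1r ?mul0r ?wps /wp; ring: c2 c3.
move=> /(wp_inj2 char2) Dfr; exists e.
have{Dfr} [c Dfr]: exists c : bool, f r + r = e%:R * s + c%:R.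
  by case: Dfr; [exists false; rewrite addr0 | exists true].
exists c, d; split=> //.
by rewrite -(addrK_pchar2 char2 r (f r)) Dfr; ring: c2 c3.
Qed.

(** Each step of the tower is separable, and [tower_action] keeps the images of the generators in
    [Nt]. *)
Lemma tower_closure_galois : galois U Nt.
Proof.
have sUN := subv_trans sUM sMN; have sMNt := subv_trans sMN sNNt.
have sUNt := subv_trans sUM sMNt.
rewrite /galois sUNt /=; apply/andP; split.
  have sep (E : {subfield L}) x : wp x \in E -> separable E <<E; x>>%AS.
    by move=> /(wp_separable char2); rewrite adjoin_separable_eq.
  apply: separable_trans (separable_trans (sep _ _ Uwq) (sep _ _ Mwr)) _.
  apply: sep.
  exact: (subvP sUN).
apply: normalField_sub_img => f fU.
have [e [c [d [fq fr fs]]]] := tower_action fU.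
have [_ Ntq Ntr] := sub_tower sNNt.
have Ntb (b : bool) : b%:R \in Nt by rewrite rpred_nat.
rewrite !aimg_adjoin fq fr fs.
apply/FadjoinP; split; last by rewrite rpredD.
apply/FadjoinP; split; last by rewrite !rpredD ?rpredM.
apply/FadjoinP; split; last by rewrite rpredD.
by apply/subvP=> _ /memv_imgP[y Uy ->]; rewrite fU ?(subvP sUNt).
Qed.

Lemma tower_gal_eq1 (a : gal_of Nt) :
  a \in 'Gal(Nt / U)%g -> a q = q -> a r = r -> a s = s -> a = 1%g.
Proof.
move=> Ga aq ar as_; apply: gal_eq1.
have sUNt: (U <= Nt)%VS by case: (sub_tower sNNt).
have sMNt: (M <= Nt)%VS := subv_trans sMN sNNt.
apply: (gal_fix_Fadjoin _ (gal_fix_Fadjoin _ _ ar) as_) => //.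
apply: (gal_fix_Fadjoin _ _ aq) => //.
by move=> y; apply: fixed_gal Ga.
Qed.

(** [a ^+ 2] fixes [q] and [s], and sends [r] to [r + e s + c + e (s + d) + c = r + e d]. *)
Lemma tower_gal_sqr (a : gal_of Nt) (e d : bool) : a \in 'Gal(Nt / U)%g ->
  a q = q + e%:R -> a s = s + d%:R -> (a ^+ 2 == 1)%g = ~~ (e && d).
Proof.
move=> Ga aq as_; have [sUNt Ntq Ntr] := sub_tower sNNt.
have [c2 c3] := pchar2_numerals char2.
have fix2 x (b : bool) : x \in Nt -> a x = x + b%:R -> (a ^+ 2)%g x = x.
  move=> Ntx ax; rewrite expgS expg1 galM // ax rmorphD rmorph_nat /= ax.
  exact: addrK_pchar2.
have a2r : (a ^+ 2)%g r = r + (e && d)%:R.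
  have aU : {in U, a =1 id} by move=> y; apply: fixed_gal Ga.
  (* The bits supplied here agree with the given [e] and [d] once cast into the field. *)
  have [e' [c [d' [aq' ar as']]]] := tower_action aU.
  move: aq' as'; rewrite aq as_ => /addrI De' /addrI Dd'.
  rewrite expgS expg1 galM // ar !rmorphD rmorphM /= !rmorph_nat ar as_ -De'.
  by case: e {aq De'} => /=; rewrite ?(mul1r, mul0r, add0r, addr0); ring: c2 c3.
apply/eqP/idP=> [a2_1 | ned].
  move/eqP: a2r; rewrite a2_1 gal_id -subr_eq0 opprD addNKr oppr_eq0.
  by case: (e && d); rewrite ?oner_eq0.
apply: tower_gal_eq1; rewrite ?groupX //; first exact: fix2 aq.
  by rewrite a2r (negPf ned) addr0.
exact: fix2 as_.
Qed.

Lemma tower_closure_id : s \in N -> Nt = N.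
Proof. by move=> Ns; apply/val_inj/Fadjoin_idP. Qed.

Lemma tower_card4 : s \in M -> r \notin M -> #|'Gal(Nt / U)%g| = 4%N.
Proof.
move=> Ms M'r; rewrite -galois_dim; last exact: tower_closure_galois.
rewrite tower_closure_id ?(subvP sMN) //.
by rewrite !wp_dim // mulnA mulnK // adim_gt0.
Qed.

(** Each of the three adjunctions doubles the degree. *)
Lemma tower_card8 : s \notin M -> #|'Gal(Nt / U)%g| = 8%N.
Proof.
move=> M's; have N's := tower_root_notin M's.
have M'r: r \notin M.
  by apply: tower_top_notin; apply: contra M's => /(subvP sUM).
rewrite -galois_dim; last exact: tower_closure_galois.
rewrite !wp_dim // ?(subvP (subv_trans sUM sMN)) //.
by rewrite !mulnA mulnK // adim_gt0.
Qed.

Lemma tower_gal_Z2Z2 : s \in U -> r \notin M ->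
  'Gal(Nt / U) \isog [set: 'Z_2 * 'Z_2].
Proof.
move=> Us M'r; apply: isog_Z2Z2 => [|a Ga].
  exact/tower_card4/M'r/(subvP sUM).
have [sUNt Ntq Ntr] := sub_tower sNNt.
have aU : {in U, a =1 id} by move=> y; apply: fixed_gal Ga.
have [e [_ [_ [aq _ _]]]] := tower_action aU.
by apply/eqP; rewrite (tower_gal_sqr (d := false) Ga aq) ?andbF // addr0 aU.
Qed.

Lemma tower_gal_Z4 : s + q \in U -> 'Gal(Nt / U) \isog [set: 'Z_4].
Proof.
move=> Usq; have [Msq _ no_both] := tower_root_trichotomy.
have M'r : r \notin M.
  by apply: tower_top_notin; apply/negP=> Us; apply: no_both.
have [sUNt Ntq Ntr] := sub_tower sNNt.
have /and3P[_ _ nUNt] := tower_closure_galois.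
have [a Ga aq] := wp_gal char2 sUNt nUNt Ntq Uwq U'q.
(* [a] fixes [s + q] and moves [q], so it also moves [s]. *)
have as_ : a s = s + true%:R.
  apply: (addIr (a q)); rewrite -rmorphD /= (fixed_gal sUNt Ga Usq) aq.
  by rewrite addrACA (addrr_pchar2 char2) addr0.
apply: (isog_Z4 _ Ga); first exact/tower_card4/M'r/Msq/or_intror.
by rewrite (tower_gal_sqr (e := true) Ga aq as_).
Qed.

Lemma tower_gal_D8 : s \notin M -> 'Gal(Nt / U) \isog 'D_8.
Proof.
move=> M's; have [sUNt Ntq Ntr] := sub_tower sNNt.
have sUN := subv_trans sUM sMN.
have /and3P[_ _ nUNt] := tower_closure_galois.
(* Taken over [U[s]], which does not contain [q]: otherwise [q] or [s + q] would lie in [U]. *)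
have [a Ga [aq as_]] : exists2 a, a \in 'Gal(Nt / U)%g & a q = q + 1 /\ a s = s.
  have sVNt : (<<U; s>> <= Nt)%VS by apply/FadjoinP.
  have V'q : q \notin <<U; s>>%VS.
    apply: contra M's => /(wp_mem_Fadjoin char2 Uws Uwq)[Uq | Usq].
      by case/negP: U'q.
    by case: tower_root_trichotomy => + _ _; apply; right.
  have nVNt := normalFieldS (subv_adjoin U s) nUNt.
  have [|a Ga aq] := wp_gal char2 sVNt nVNt Ntq _ V'q.
    exact: subvP (subv_adjoin U s) _ Uwq.
  exists a; first exact: subsetP (galS _ (subv_adjoin U s)) _ Ga.
  by rewrite (fixed_gal sVNt Ga (memv_adjoin U s)).
(* Taken over [N], which contains [q] but not [s]. *)
have [b Gb [bq bs]] : exists2 b, b \in 'Gal(Nt / U)%g & b q = q /\ b s = s + 1.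
  have N's := tower_root_notin M's.
  have [|b Gb bs] := wp_gal char2 sNNt (normalFieldS sUN nUNt) Nts _ N's.
    exact: subvP sUN _ Uws.
  exists b; first exact: subsetP (galS _ sUN) _ Gb.
  by rewrite (fixed_gal sNNt Gb) // (subvP sMN).
apply: (isog_D8 (tower_card8 M's) Ga Gb).
- by apply/eqP; rewrite (tower_gal_sqr (e := true) (d := false) Ga) ?addr0.
- by apply/eqP; rewrite (tower_gal_sqr (e := false) (d := true) Gb) ?addr0.
rewrite (tower_gal_sqr (e := true) (d := true)) ?groupM //.
- by rewrite galM // aq rmorphD rmorph1 /= bq.
- by rewrite galM // as_ bs.
Qed.

(** For minimality, a Galois [E] above [N] contains a root of [wp x = g], hence [s]. *)
Lemma tower_closureP : galois_closure U N Nt.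
Proof.
split=> // [|E sNE /and3P[_ _ nUE]]; first exact: tower_closure_galois.
have [x Ex wpx] := normal_tower_root sNE nUE.
by apply/FadjoinP; split=> //; apply: wp_root_mem Ex _; rewrite wpx.
Qed.

Lemma tower_not_galois : s \notin M -> ~~ galois U N.
Proof.
move=> M's; apply: contra (tower_root_notin M's) => /and3P[_ _ nUN].
have [x Nx wpx] := normal_tower_root (subvv N) nUN.
by apply: wp_root_mem Nx _; rewrite wpx.
Qed.

End Tower.

(** * Translation from the algebraic closure to subfields of [L] *)

Section SubfieldImage.

Variables (F0 : fieldType) (L : splittingFieldType F0) (E : fieldType).
Variable j : {rmorphism L -> E}.
Implicit Types (V W : {subfield L}) (S : E -> Prop).

Lemma subfield_imageE V x : subfield_image j V (j x) <-> x \in V.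
Proof. by split=> [[y Vy /fmorph_inj->] | Vx]; last exists x. Qed.

(** Any witness of the class equality is [j x] or [j x + 1], so equality of classes becomes
    membership of a single element. *)
Lemma subfield_image_class_eq V S a b x : 2%N \in [pchar E] ->
    (forall y, S y <-> subfield_image j V y) -> a + b = wp (j x) ->
  class_eq S a b <-> x \in V.
Proof.
move=> char2 SV abx; split=> [[c /SV[v Vv ->]] | Vx]; last first.
  by exists (j x) => //; apply/SV/subfield_imageE.
by rewrite abx => /(wp_inj2 char2)[/fmorph_inj-> //|];
  rewrite -(rmorph1 j) -rmorphD => /fmorph_inj->; rewrite rpredD ?rpred1.
Qed.

Lemma mem_ring_adjoin S x : S 0 -> S 1 -> ring_adjoin S x x.
Proof.
by move=> S0 S1; exists 'X; rewrite ?hornerX // => i; rewrite coefX; case: eqP.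
Qed.

Lemma ring_adjoin_image V S x y : (forall z, S z <-> subfield_image j V z) ->
  ring_adjoin S (j x) y -> subfield_image j <<V; x>>%AS y.
Proof.
move=> SV [p Sp ->]; rewrite horner_coef.
have sVx := subvP (subv_adjoin V x).
apply: big_ind => [|_ _ [u Vu ->] [v Vv ->]|i _].
- by exists 0; rewrite ?rmorph0 ?rpred0.
- by exists (u + v); rewrite ?rmorphD ?rpredD.
have /SV[v Vv ->] := Sp i.
exists (v * x ^+ i); last by rewrite rmorphM rmorphXn.
by rewrite rpredM ?rpredX ?memv_adjoin ?sVx.
Qed.

(** Pulls a presentation such as M = K[q] back along [j], with a preimage of the generator. *)
Lemma ring_adjoin_Fadjoin V W S y : (V <= W)%VS ->
    (forall z, S z <-> subfield_image j V z) ->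
    (forall z, subfield_image j W z <-> ring_adjoin S y z) ->
  exists2 x, y = j x & W = <<V; x>>%AS.
Proof.
move=> sVW SV WSy; have [x Wx Dy] : subfield_image j W y.
  apply/WSy/mem_ring_adjoin; apply/SV.
    by rewrite -(rmorph0 j); apply/subfield_imageE/rpred0.
  by rewrite -(rmorph1 j); apply/subfield_imageE/rpred1.
exists x => //; apply/val_inj/eqP; rewrite eqEsubv; apply/andP; split.
  apply/subvP=> w Ww; apply/subfield_imageE/(ring_adjoin_image SV).
  by rewrite -Dy; apply/WSy/subfield_imageE.
exact/FadjoinP.
Qed.

End SubfieldImage.

(* The subfields M and N of the algebraic closure Kalg are the images under j
   of subfields of L, a finite normal extension of K embedded in Kalg. *)
Theorem proposition3p6 (K : fieldType) (Kalg : closedFieldType)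
    (iota : {rmorphism K -> Kalg})
    (L : splittingFieldType K) (j : {rmorphism L -> Kalg})
    (M N : {subfield L}) (F G H : K) (q r s : Kalg) :
  let inK := field_image iota in
  let inM := subfield_image j M in
  let inN := subfield_image j N in
  let case1 := class_eq inK (iota G) 0
               /\ class_eq inM (iota H) (iota F * s ^+ 2) in
  let case2 := class_eq inK (iota G) 0
               /\ ~ class_eq inM (iota H) (iota F * s ^+ 2) in
  let case3 := class_eq inK (iota G) (iota F) in
  let case4 := ~ class_eq inM (iota G) 0 in
  (2%N \in [pchar K]) ->
  (forall x : Kalg, algebraicOver iota x) ->
  (forall a : K, j a%:A = iota a) ->
  separable 1 M -> \dim_(1%AS : {subfield L}) M = 2%N ->
  (M <= N)%VS -> separable M N -> (\dim_M N <= 2)%N ->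
  q ^+ 2 + q = iota F ->
  r ^+ 2 + r = iota G * q + iota H ->
  s ^+ 2 + s = iota G ->
  (forall y : Kalg, inM y <-> ring_adjoin inK q y) ->
  (forall y : Kalg, inN y <-> ring_adjoin inM r y) ->
  [/\ exactly_one4 case1 case2 case3 case4,
      case1 -> N = M,
      case2 -> galois 1 N
               /\ 'Gal(N / 1) \isog [set: 'Z_2 * 'Z_2],
      case3 -> galois 1 N
               /\ 'Gal(N / 1) \isog [set: 'Z_4]
    & case4 -> ~~ galois 1 N
               /\ exists Nt : {subfield L},
                    galois_closure 1 N Nt /\ 'Gal(Nt / 1) \isog 'D_8].
Proof.
move=> inK inM inN case1 case2 case3 case4 char2K _ jA _ dimM sMN _ _.
move=> wpq wpr wps inMq inNr.
have char2 : 2%N \in [pchar L] by rewrite (fmorph_pchar (in_alg L)).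
have char2' : 2%N \in [pchar Kalg] by rewrite (fmorph_pchar iota).
have inK1 y : inK y <-> subfield_image j 1%AS y.
  split=> [[a ->] | [_ /vlineP[a ->] ->]]; last by exists a; rewrite jA.
  by exists a%:A; rewrite ?jA ?rpredZ ?rpred1.
have [x Dq DM] := ring_adjoin_Fadjoin (sub1v M) inK1 inMq.
have inMM y : inM y <-> subfield_image j M y by [].
have [y Dr DN] := ring_adjoin_Fadjoin sMN inMM inNr.
have K1 (a : K) : a%:A \in (1%AS : {subfield L}) by rewrite rpredZ ?rpred1.
have wpx : wp x = F%:A.
  by apply: (fmorph_inj j); rewrite fmorph_wp -Dq jA.
have wpy : wp y = G%:A * x + H%:A.
  by apply: (fmorph_inj j); rewrite fmorph_wp -Dr rmorphD rmorphM -Dq !jA.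
have Ux : wp x \in (1%AS : {subfield L}) by rewrite wpx K1.
have U'x : x \notin (1%AS : {subfield L}).
  apply: contra_eqN dimM => Kx; rewrite DM /=.
  by rewrite (Fadjoin_idP Kx) divnn adim_gt0.
(* [s] is given only in [Kalg]. Since [L] is itself normal and contains the tower, it holds a root
   [t] of [wp t = G], and [s] is [j t] or [j (t + 1)]. *)
have [z Ds] : exists z, s = j z.
  have [t _ wpt] := normal_tower_root char2 Ux U'x (K1 G) (K1 H) wpy
                      (subvf _) (normalFieldf _).
  have /(wp_inj2 char2')[->|->]: wp s = wp (j t); last 2 first.
  - by exists t.
  - by exists (t + 1); rewrite rmorphD rmorph1.
  by rewrite -fmorph_wp wpt jA.
have wpz : wp z = G%:A.
  by apply: (fmorph_inj j); rewrite fmorph_wp -Ds jA.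
have G0P (S : Kalg -> Prop) V : (forall y, S y <-> subfield_image j V y) ->
    class_eq S (iota G) 0 <-> z \in V.
  move=> SV; apply: subfield_image_class_eq => //.
  by rewrite addr0 -fmorph_wp wpz jA.
(* [y + z * x] is the preimage of r + s q, whose image under [wp] is H + F s^2 because G q = s^2 q +
   s q. *)
have HP : class_eq inM (iota H) (iota F * s ^+ 2) <-> y + z * x \in M.
  apply: subfield_image_class_eq => //.
  rewrite rmorphD rmorphM wpD // -fmorph_wp wpy rmorphD rmorphM !jA -Ds -Dq.
  have [c2 c3] := pchar2_numerals char2'.
  by rewrite -wpq -wps /wp; ring: c2 c3.
have GFP : case3 <-> z + x \in (1%AS : {subfield L}).
  apply: subfield_image_class_eq => //.
  by rewrite -fmorph_wp wpD // wpz wpx rmorphD !jA.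
have {G0P} [GKP GMP] := (G0P _ _ inK1, G0P _ _ inMM).
subst N M; clear inN inNr inMq inMM sMN dimM.
have [MU UM not_both] := tower_root_trichotomy char2 Ux U'x (K1 G) wpz.
have Mzx (Kz : z \in (1%AS : {subfield L})) :
    (y + z * x \in <<1; x>>%AS) = (y \in <<1; x>>%AS).
  by rewrite rpredDr // rpredM ?memv_adjoin // MU //; left.
(* In the second and third cases [N] is its own closure, so the results on the closure apply to
   it. *)
have N_id : z \in <<1; x>>%AS ->
    <<<<<<1; x>>%AS; y>>%AS; z>>%AS = <<<<1; x>>%AS; y>>%AS.
  by move=> Mz; apply: tower_closure_id; apply: subvP (subv_adjoin _ y) _ Mz.
have galNt := tower_closure_galois char2 Ux (K1 G) (K1 H) wpy wpz.
split.
(* All hypotheses are now memberships of [z], [z + x] and [y + z * x]; with the trichotomy, what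
   remains is propositional. *)
- rewrite /case1 /case2 /case4.
  have [Kz | /negP K'z] := boolP (z \in (1%AS : {subfield L})).
    have [Myz | /negP M'yz] := boolP (y + z * x \in <<1; x>>%AS).
      by apply: Or41; split; tauto.
    by apply: Or42; split; tauto.
  have [Kzx | /negP K'zx] := boolP (z + x \in (1%AS : {subfield L})).
    by apply: Or43; split; tauto.
  by apply: Or44; split; tauto.
- case=> /GKP Kz /HP; rewrite Mzx // => My.
  exact/val_inj/Fadjoin_idP.
- case=> /GKP Kz /HP; rewrite Mzx // => /negP M'y.
  rewrite -N_id; last by apply: MU; left.
  split=> //; exact: (tower_gal_Z2Z2 char2 Ux U'x (K1 G) (K1 H) wpy wpz Kz M'y).
- move=> /GFP Kzx; rewrite -N_id; last by apply: MU; right.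
  split=> //; exact: (tower_gal_Z4 char2 Ux U'x (K1 G) (K1 H) wpy wpz Kzx).
move=> Mz'; have M'z : z \notin <<1; x>>%AS by apply/negP=> /GMP.
split; first exact: (tower_not_galois char2 Ux U'x (K1 G) (K1 H) wpy wpz M'z).
exists <<<<<<1; x>>%AS; y>>%AS; z>>%AS; split; last first.
  exact: (tower_gal_D8 char2 Ux U'x (K1 G) (K1 H) wpy wpz M'z).
exact: (tower_closureP char2 Ux U'x (K1 G) (K1 H) wpy wpz).
Qed.
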